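(* Let $t_f>0$, let $\Delta>0$ be a fixed minimum travel time, and let $\mu^0,\mu^{\mathcal T}$ be nonnegative measures on $[0,t_f]$ with $\int_0^{t_f}\mu^0(dt_0)=\int_0^{t_f}\mu^{\mathcal T}(dt_{\mathcal T})=1$. Put $F_0(t)=\int_0^t\mu^0(ds)$ and $F_{\mathcal T}(t)=\int_0^t\mu^{\mathcal T}(d\tau)$. Then the pair $(\mu^0,\mu^{\mathcal T})$ is feasible if and only if $\mu^0$ is dominated by the $\Delta$-shift of $\mu^{\mathcal T}$ in first-order stochastic order, that is, $$F_0(t)\ \ge\ F_{\mathcal T}(t+\Delta)\qquad\text{for all } t\in[0,t_f].$$ Equivalently, for every bounded increasing function $\phi:\mathbb R\to\mathbb R$, $$\int_0^{t_f}\phi(t)\,\mu^0(dt)\ \le\ \int_0^{t_f}\phi(t-\Delta)\,\mu^{\mathcal T}(dt),$$ with $\phi(t-\Delta)$ understood as $\phi(0)$ when $t<\Delta$. In particular, if the pair is feasible, then $$\inf\operatorname{Supp}(\mu^{\mathcal T})\ge \inf\operatorname{Supp}(\mu^0)+\Delta,\qquad \sup\operatorname{Supp}(\mu^{\mathcal T})\ge \sup\operatorname{Supp}(\mu^0)+\Delta .$$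
   Context: $\mu^0$ is the distribution of departure times from the source and $\mu^{\mathcal T}$ the distribution of arrival times at the sink. The pair $(\mu^0,\mu^{\mathcal T})$ is called feasible (for the minimum travel time $\Delta$) if there is a coupling, i.e. a probability measure on $[0,t_f]^2$ with first marginal $\mu^0$ (variable $t_0$) and second marginal $\mu^{\mathcal T}$ (variable $t_{\mathcal T}$), such that $t_{\mathcal T}-t_0\ge\Delta$ almost surely. The measures are regarded as measures carried by $[0,t_f]$, so $F_{\mathcal T}(s)=1$ for $s\ge t_f$. $\operatorname{Supp}(\cdot)$ denotes the support of a measure; ''increasing'' means non-decreasing.
   Formalization: Feasibility is shown equivalent to the condition F_0(t) ≥ F_T(t+Δ) together with μ^T([0,Δ)) = 0; without this extra condition the claim fails (μ^0 = μ^T = δ_0 satisfies both displayed conditions but is not feasible). *)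

(* Defs.v *)
From HB Require Import structures.
From mathcomp Require Import all_boot all_order all_algebra.
From mathcomp Require Import all_classical all_reals all_analysis.

Set Implicit Arguments.
Unset Strict Implicit.
Unset Printing Implicit Defensive.

Import Order.TTheory GRing.Theory Num.Theory.
Import numFieldNormedType.Exports.

Local Open Scope classical_set_scope.
Local Open Scope ring_scope.

(* A measure on [0, tf] is encoded as a Borel measure on the whole line that
   gives no mass to the complement of [0, tf]. *)
Definition carried_by (R : realType) (tf : R)
    (mu : {measure set (measurableTypeR R) -> \bar R}) : Prop :=
  mu (~` `[0, tf]%classic) = 0%E.

(* The atom at the origin, if any, is counted: F 0 = mu {0}. *)
Definition cumul (R : realType) (mu : {measure set (measurableTypeR R) -> \bar R})
    (t : R) : \bar R :=
  mu `[0, t]%classic.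

Definition supp (R : realType) (mu : {measure set (measurableTypeR R) -> \bar R})
    : set R :=
  [set x : R | forall U : set R, open U -> U x -> (0 < mu U)%E].

Definition coupling (R : realType) (tf : R)
    (mu0 muT : {measure set (measurableTypeR R) -> \bar R})
    (P : probability (measurableTypeR R * measurableTypeR R)%type R) : Prop :=
  [/\ P (~` (`[0, tf]%classic `*` `[0, tf]%classic)) = 0%E,
      forall A : set (measurableTypeR R), measurable A ->
        P (fst @^-1` A) = mu0 A
    & forall A : set (measurableTypeR R), measurable A ->
        P (snd @^-1` A) = muT A].

Definition feasible (R : realType) (tf Delta : R)
    (mu0 muT : {measure set (measurableTypeR R) -> \bar R}) : Prop :=
  exists2 P : probability (measurableTypeR R * measurableTypeR R)%type R,
    coupling tf mu0 muT P & {ae P, forall z, Delta <= (z.2 : R) - z.1}.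

(* Only t >= 0 is tested, so an atom of mu0 at 0 can hide arrivals before Delta:
   mu0 = muT = delta_0 satisfies this condition and is not feasible.  Feasibility
   is this condition together with muT `[0, Delta[ = 0. *)
Definition shift_dominated (R : realType) (tf Delta : R)
    (mu0 muT : {measure set (measurableTypeR R) -> \bar R}) : Prop :=
  forall t : R, 0 <= t <= tf -> (cumul muT (t + Delta) <= cumul mu0 t)%E.

(* phi (t - Delta), read as phi 0 when t < Delta. *)
Definition shift_fun (R : realType) (Delta : R) (phi : R -> R) (t : R) : R :=
  if t < Delta then phi 0 else phi (t - Delta).

Definition shift_dominated_fun (R : realType) (tf Delta : R)
    (mu0 muT : {measure set (measurableTypeR R) -> \bar R}) : Prop :=
  forall phi : R -> R, bounded_fun phi -> {homo phi : x y / x <= y} ->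
    (\int[mu0]_(t in `[0%R, tf]) (phi t)%:E <=
     \int[muT]_(t in `[0%R, tf]) (shift_fun Delta phi t)%:E)%E.

(* Main.v *)
Require Import Defs.
From HB Require Import structures.
From mathcomp Require Import all_boot all_order all_algebra finmap.
From mathcomp Require Import all_classical all_reals all_analysis.
From mathcomp Require Import measurable_realfun.

Set Implicit Arguments.
Unset Strict Implicit.
Unset Printing Implicit Defensive.

Import Order.TTheory GRing.Theory Num.Theory.
Import numFieldNormedType.Exports.

Local Open Scope classical_set_scope.
Local Open Scope ring_scope.

(* Everything that domination implies comes from the quantile coupling: if Q0 and QT are the quantile
   functions of mu0 and muT, the image of the uniform law on [0, 1] by
   u |-> (Q0 u, QT u) is a coupling of mu0 and muT, and domination yields
   Q0 u <= max (QT u - Delta) 0 for every u.  When muT does not charge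
   [0, Delta[, QT u >= Delta almost surely, so the travel time is at least Delta.
   For a monotone phi, the pointwise inequality between quantiles integrates to
   the inequality between the integrals of phi and of its shift; conversely, the
   indicator functions of the half-lines ]t, +oo[ give domination back. *)

(** * Distribution functions of measures carried by [0, tf] *)

Lemma carried_setI (R : realType) (tf : R)
    (mu : {measure set (measurableTypeR R) -> \bar R}) (A : set R) :
  carried_by tf mu -> measurable A -> mu (A `&` `[0, tf]) = mu A.
Proof.
move=> c mA.
have mI : measurable (`[0, tf]%classic : set R) by exact: measurable_itv.
rewrite [RHS](measureDI mu mA mI).
rewrite -[LHS]add0e; congr (_ + _)%E; apply/esym.
apply: (subset_measure0 _ _ _ c); first exact: measurableD.
  exact: measurableC.
by move=> x [].
Qed.

(** Passage between distribution functions and tails: the tails generate the Borel sets and are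
    integrals of monotone indicators. *)
Lemma cumul_ltyE (R : realType) (tf : R)
    (mu : {measure set (measurableTypeR R) -> \bar R}) (t : R) :
  carried_by tf mu -> mu `[0, tf]%classic = 1%E -> 0 <= t ->
  (cumul mu t + mu (`]t, +oo[%classic : set R) = 1)%E.
Proof.
move=> c m t0.
have mI : measurable (`[0, tf]%classic : set R) by exact: measurable_itv.
have mt : measurable (`]t, +oo[%classic : set R) by exact: measurable_itv.
rewrite -m (measureDI mu mI mt); congr (_ + _)%E; last first.
  by rewrite setIC; apply/esym; exact: carried_setI.
rewrite /cumul -(carried_setI c)//.
congr (mu _); apply/seteqP; split=> x /=; rewrite !in_itv/= ?andbT.
  by move=> [/andP[x0 xt] ->]; split=> //; apply/negP; rewrite -leNgt.
by move=> [/andP[-> ->] /negP]; rewrite -leNgt => ->.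
Qed.

Lemma cumul_fin (R : realType) (tf : R)
    (mu : {measure set (measurableTypeR R) -> \bar R}) (t : R) :
  carried_by tf mu -> mu `[0, tf]%classic = 1%E ->
  cumul mu t \is a fin_num /\ (cumul mu t <= 1)%E.
Proof.
move=> c m; suff le1 : (cumul mu t <= 1)%E.
  by split=> //; rewrite ge0_fin_numE ?(le_lt_trans le1) ?ltry// /cumul.
rewrite /cumul -(carried_setI c)// -m measureIr//; exact: measurable_itv.
Qed.

Lemma le_cumul (R : realType) (mu : {measure set (measurableTypeR R) -> \bar R})
    (s t : R) : s <= t -> (cumul mu s <= cumul mu t)%E.
Proof.
move=> st; rewrite /cumul le_measure ?inE//.
by apply: subset_itvl; rewrite bnd_simp.
Qed.

(** Right-continuity, from continuity from above along [0, t + 1/(n+1)], in the form that makes the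
    infimum in [quantile] attained. *)
Lemma cumul_right_closed (R : realType) (tf : R)
    (mu : {measure set (measurableTypeR R) -> \bar R}) (t : R) (v : \bar R) :
  carried_by tf mu -> mu `[0, tf]%classic = 1%E ->
  (forall e, 0 < e -> (v <= cumul mu (t + e))%E) -> (v <= cumul mu t)%E.
Proof.
move=> c m vt.
pose F n := `[0, t + n.+1%:R^-1]%classic : set R.
have -> : cumul mu t = mu (\bigcap_n F n).
  rewrite /cumul; congr (mu _); apply/seteqP; split=> x; rewrite /F/= in_itv/=.
    by move=> /andP[x0 xt] n _ /=; rewrite in_itv/= x0 ler_wpDr.
  move=> Fx; have := Fx 0%N I; rewrite /= in_itv/= => /andP[-> _] /=.
  rewrite leNgt; apply/negP => /ltr_add_invr[k tk].
  by have := Fx k I; rewrite /= in_itv/= => /andP[_]; rewrite leNgt tk.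
have cv : mu \o F @ \oo --> mu (\bigcap_n F n).
  apply: nonincreasing_cvg_mu.
  - have [fF _] := cumul_fin (t + 1%:R^-1) c m.
    by rewrite -ge0_fin_numE.
  - by move=> n; exact: measurable_itv.
  - by apply: bigcap_measurable => // n _; exact: measurable_itv.
  - move=> k n kn; apply/subsetPset; apply: subset_itvl.
    by rewrite bnd_simp lerD2l lef_pV2 ?posrE// ler_nat.
rewrite -(cvg_lim _ cv)//; apply: lime_ge.
  by apply/cvg_ex; eexists; exact: cv.
by near=> n; apply: vt; rewrite invr_gt0.
Unshelve. all: by end_near. Qed.

(** * Quantile functions *)

(* Truncating the level u at 1 makes the set nonempty for every u, so that the
   quantile is monotone on the whole line with values in [0, tf]. *)
Definition quantile (R : realType)
    (mu : {measure set (measurableTypeR R) -> \bar R}) (u : R) : R :=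
  inf [set x | 0 <= x /\ ((Num.min u 1)%:E <= cumul mu x)%E].

(** Galois connection between quantile and distribution function: the set [S] is upward closed,
    contains [tf], and contains its infimum by right-continuity. Bounds, monotonicity and law of the
    quantile are read off from it. *)
Lemma quantile_leP (R : realType) (tf : R)
    (mu : {measure set (measurableTypeR R) -> \bar R}) (u x : R) :
  0 < tf -> carried_by tf mu -> mu `[0, tf]%classic = 1%E ->
  quantile mu u <= x <-> 0 <= x /\ ((Num.min u 1)%:E <= cumul mu x)%E.
Proof.
move=> tf0 c m.
set S := [set x | 0 <= x /\ ((Num.min u 1)%:E <= cumul mu x)%E].
have lS : has_lbound S by exists 0 => y [].
have nS : S !=set0.
  exists tf; split; first exact: ltW.
  by rewrite /cumul m lee_fin ge_min lexx orbT.
have SS s t : s <= t -> S s -> S t.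
  move=> st [s0 Ss]; split; first exact: le_trans st.
  exact: le_trans (le_cumul _ st).
have q0 : 0 <= quantile mu u by apply: lb_le_inf => // y [].
split=> [|Sx]; last exact: ge_inf.
move=> /SS; apply; split=> //.
apply: (cumul_right_closed c m) => // e e0.
have [|y [_ Sy] /ltW ye] := @inf_adherent _ S e e0; first by split.
exact: le_trans (le_cumul _ ye).
Qed.

Lemma quantile_ge0 (R : realType) (tf : R)
    (mu : {measure set (measurableTypeR R) -> \bar R}) (u : R) :
  0 < tf -> carried_by tf mu -> mu `[0, tf]%classic = 1%E ->
  0 <= quantile mu u.
Proof.
move=> tf0 c m.
by have [/(_ (lexx _))[]] := quantile_leP u (quantile mu u) tf0 c m.
Qed.

Lemma quantile_le (R : realType) (tf : R)
    (mu : {measure set (measurableTypeR R) -> \bar R}) (u : R) :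
  0 < tf -> carried_by tf mu -> mu `[0, tf]%classic = 1%E ->
  quantile mu u <= tf.
Proof.
move=> tf0 c m; apply/(quantile_leP _ _ tf0 c m); split; first exact: ltW.
by rewrite /cumul m lee_fin ge_min lexx orbT.
Qed.

Lemma quantile_nondecreasing (R : realType) (tf : R)
    (mu : {measure set (measurableTypeR R) -> \bar R}) :
  0 < tf -> carried_by tf mu -> mu `[0, tf]%classic = 1%E ->
  {homo quantile mu : u v / u <= v}.
Proof.
move=> tf0 c m u v uv; apply/(quantile_leP _ _ tf0 c m).
have [/(_ (lexx _))[q0 qv] _] := quantile_leP v (quantile mu v) tf0 c m.
by split=> //; apply: le_trans qv; rewrite lee_fin le_min2.
Qed.

Lemma measurable_quantile (R : realType) (tf : R)
    (mu : {measure set (measurableTypeR R) -> \bar R}) :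
  0 < tf -> carried_by tf mu -> mu `[0, tf]%classic = 1%E ->
  measurable_fun [set: measurableTypeR R] (quantile mu : _ -> measurableTypeR R).
Proof.
move=> tf0 c m; apply: nondecreasing_measurable => //.
exact: (quantile_nondecreasing tf0 c m).
Qed.

(** * The image of the uniform law under a quantile function *)

Lemma uniform_prob01E (R : realType) (A : set R) : measurable A ->
  uniform_prob (@ltr01 R) A = lebesgue_measure (A `&` `[0, 1]%classic).
Proof.
move=> mA; rewrite /uniform_prob integral_uniform_pdf.
rewrite (eq_integral (fun=> 1%E)) ?integral_cst ?mul1e//.
  by apply: measurableI => //; exact: measurable_itv.
move=> x; rewrite inE/= in_itv/= /uniform_pdf => -[_ ->].
by rewrite subr0 invr1.
Qed.

(** Two finite measures are compared on the half-lines ]x, +oo[. For x >= 0 the Galois connection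
    turns the preimage within [0, 1] into ]F, 1], where F is the distribution function at x, and 1 -
    F is the mass of the tail. *)
Lemma uniform_prob_quantile (R : realType) (tf : R)
    (mu : {measure set (measurableTypeR R) -> \bar R}) (A : set R) :
  0 < tf -> carried_by tf mu -> mu `[0, tf]%classic = 1%E ->
  measurable A -> uniform_prob (@ltr01 R) (quantile mu @^-1` A) = mu A.
Proof.
move=> tf0 c m mA; have mQ := measurable_quantile tf0 c m.
pose Q : {mfun measurableTypeR R >-> measurableTypeR R} :=
  HB.pack (quantile mu : measurableTypeR R -> measurableTypeR R)
    (isMeasurableFun.Build _ _ _ _ _ mQ).
pose P := distribution (uniform_prob (@ltr01 R)) Q.
have PE x : P (`]x, +oo[%classic : set R) = mu (`]x, +oo[%classic : set R).
  transitivity (lebesgue_measure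
      ((quantile mu @^-1` `]x, +oo[%classic) `&` `[0, 1]%classic)).
    apply: uniform_prob01E; rewrite -[X in measurable X]setTI.
    exact: (mQ measurableT _ (measurable_itv _)).
  (* For x < 0 the tail identity [cumul_ltyE] does not apply; both sides are then 1, as quantiles
     and carrier are nonnegative. *)
  have [x0|x0] := ltP x 0.
    rewrite (_ : _ `&` _ = `[0, 1]%classic); last first.
      apply/seteqP; split=> u /=; first by case.
      move=> ->; split=> //; rewrite in_itv/= andbT (lt_le_trans x0)//.
      exact: quantile_ge0 tf0 c m.
    rewrite lebesgue_measure_itv/= lte_fin ltr01 sube0.
    rewrite -(carried_setI c)// -m; congr (mu _).
    apply/esym/setIidPr => y /=; rewrite !in_itv/= andbT => /andP[y0 _].
    exact: lt_le_trans y0.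
  have [fF F1] := cumul_fin x c m.
  have F0 : (0 <= cumul mu x)%E by exact: measure_ge0.
  move: (cumul_ltyE c m x0); rewrite addeC => /eqP.
  rewrite eq_sym -sube_eq ?fin_num_adde_defl// => /eqP <-.
  move: (fF) F1 F0; rewrite -(fineK fF); set F := fine _ => _.
  rewrite !lee_fin => F1 F0.
  rewrite (_ : _ `&` _ = `]F, 1]%classic); last first.
    apply/seteqP; split=> u /=; rewrite !in_itv/= ?andbT.
      move=> [xq /andP[u0 u1]]; rewrite u1 andbT ltNge; apply/negP => uF.
      move: xq; rewrite ltNge => /negP; apply.
      apply/(quantile_leP _ _ tf0 c m); split => //.
      by rewrite -(fineK fF) lee_fin ge_min uF.
    move=> /andP[Fu u1]; split; last by rewrite u1 (le_trans F0 (ltW Fu)).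
    rewrite ltNge; apply/negP => /(quantile_leP _ _ tf0 c m)[_].
    by rewrite -(fineK fF) lee_fin min_l// leNgt Fu.
  (* If F = 1 the interval is empty and the length formula returns 0, which is still 1 - F. *)
  rewrite lebesgue_measure_itv/= lte_fin; case: ltP => // F1'.
  by rewrite (@le_anti _ _ F 1) ?F1 ?F1'// subee.
have mA' : @measurable _ (measurableTypeR R) A by exact: mA.
change (P A = mu A).
(* The half-lines form a pi-system generating the Borel sets, and the sets ]-n, +oo[ exhaust the
   line with finite mass. *)
apply: (@measure_unique _ _ (measurableTypeR R) (@RGenOInfty.G R)
  (fun n => `](- n%:R), +oo[%classic) _ _ _ _ P mu _ _ A mA') => //.
- exact: RGenOInfty.measurableE.
- move=> _ _ [x ->] [y ->]; exists (Num.max x y).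
  apply/predeqP => z /=; rewrite !in_itv/= !andbT gt_max.
  by split=> [[-> ->]|/andP[]].
- by move=> i; exists (- i%:R).
- apply/seteqP; split=> // x _; exists (Num.truncn `|x|).+1 => //=.
  rewrite in_itv/= andbT ltrNl (le_lt_trans _ (truncnS_gt _))//.
  by rewrite -normrN ler_norm.
- by move=> B [x ->]; exact: PE.
- move=> k; rewrite (@le_lt_trans _ _ 1%E) ?ltry//.
  rewrite /P /distribution /pushforward probability_le1//.
Qed.

Lemma integrable_quantile (R : realType) (tf : R)
    (mu : {measure set (measurableTypeR R) -> \bar R}) (f : R -> R) :
  0 < tf -> carried_by tf mu -> mu `[0, tf]%classic = 1%E ->
  measurable_fun [set: R] f -> bounded_fun f ->
  (uniform_prob (@ltr01 R)).-integrable [set: measurableTypeR R]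
    (fun u => (f (quantile mu u))%:E).
Proof.
move=> tf0 c m mf [M [rM bM]].
apply: (@measurable_bounded_integrable _ (measurableTypeR R) R
  (uniform_prob (@ltr01 R)) (f \o quantile mu)) => //.
- by rewrite (@le_lt_trans _ _ 1%E) ?ltry// probability_le1.
- apply: (@measurableT_comp _ _ _ _ (measurableTypeR R)) => //.
  exact: measurable_quantile tf0 c m.
- by exists M; split=> // N MN u _ /=; exact: bM.
Qed.

(** Change of variables: [mu] is the image law, and quantiles never leave [0, tf], so the domain of
    integration pulls back to the whole line. *)
Lemma integral_quantile (R : realType) (tf : R)
    (mu : {measure set (measurableTypeR R) -> \bar R}) (f : R -> R) :
  0 < tf -> carried_by tf mu -> mu `[0, tf]%classic = 1%E ->
  measurable_fun [set: R] f -> bounded_fun f ->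
  (\int[mu]_(t in `[0%R, tf]) (f t)%:E =
   \int[uniform_prob (@ltr01 R)]_u (f (quantile mu u))%:E)%E.
Proof.
move=> tf0 c m mf bf; have mQ := measurable_quantile tf0 c m.
pose Q : {mfun measurableTypeR R >-> measurableTypeR R} :=
  HB.pack (quantile mu : measurableTypeR R -> measurableTypeR R)
    (isMeasurableFun.Build _ _ _ _ _ mQ).
have QI : Q @^-1` `[0, tf] = setT.
  apply/seteqP; split=> // u _ /=.
  by rewrite in_itv/= (quantile_ge0 u tf0 c m) (quantile_le u tf0 c m).
rewrite (@eq_measure_integral _ _ _ _ (distribution (uniform_prob (@ltr01 R)) Q)).
  rewrite integral_pushforward//.
  - by rewrite QI.
  - exact: measurableT_comp.
  - by rewrite QI; exact: (integrable_quantile tf0 c m mf bf).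
by move=> A mA _; apply/esym; exact: (uniform_prob_quantile tf0 c m mA).
Qed.

(** * From domination to a feasible coupling *)

(** With s the quantile of [muT], domination is applied at t = max (s - Delta) 0, the least
    admissible time with t + Delta >= s; the maximum is there because only t >= 0 is tested. *)
Lemma shift_dominated_quantile (R : realType) (tf Delta : R)
    (mu0 muT : {measure set (measurableTypeR R) -> \bar R}) (u : R) :
  0 < tf -> 0 < Delta -> carried_by tf mu0 -> carried_by tf muT ->
  mu0 `[0, tf]%classic = 1%E -> muT `[0, tf]%classic = 1%E ->
  shift_dominated tf Delta mu0 muT ->
  quantile mu0 u <= Num.max (quantile muT u - Delta) 0.
Proof.
move=> tf0 D0 c0 cT m0 mT dom; set s := quantile muT u.
have [/(_ (lexx _))[s0 us] _] := quantile_leP u s tf0 cT mT.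
apply/(quantile_leP _ _ tf0 c0 m0).
have M0 : 0 <= Num.max (s - Delta) 0 by rewrite le_max lexx orbT.
split=> //; apply: (le_trans us).
apply: (@le_trans _ _ (cumul muT (Num.max (s - Delta) 0 + Delta))).
  by apply: le_cumul; rewrite -lerBlDr le_max lexx.
apply: dom; rewrite M0 ge_max (ltW tf0) andbT lerBlDr.
by rewrite (le_trans (quantile_le u tf0 cT mT))// lerDl ltW.
Qed.

Lemma dominated_feasible (R : realType) (tf Delta : R)
    (mu0 muT : {measure set (measurableTypeR R) -> \bar R}) :
  0 < tf -> 0 < Delta -> carried_by tf mu0 -> carried_by tf muT ->
  mu0 `[0, tf]%classic = 1%E -> muT `[0, tf]%classic = 1%E ->
  muT `[0, Delta[%classic = 0%E -> shift_dominated tf Delta mu0 muT ->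
  feasible tf Delta mu0 muT.
Proof.
move=> tf0 D0 c0 cT m0 mT muTD dom.
have mQ0 := measurable_quantile tf0 c0 m0.
have mQT := measurable_quantile tf0 cT mT.
have mZ := measurable_fun_pair mQ0 mQT.
pose T := (measurableTypeR R * measurableTypeR R)%type.
pose Z : {mfun measurableTypeR R >-> T} :=
  HB.pack (fun u : measurableTypeR R => (quantile mu0 u, quantile muT u))
    (isMeasurableFun.Build _ _ _ _ _ mZ).
exists (distribution (uniform_prob (@ltr01 R)) Z).
  split.
  - rewrite /distribution /pushforward.
    transitivity (uniform_prob (@ltr01 R) set0); last exact: measure0.
    congr (uniform_prob _ _); rewrite -subset0 => u /=.
    apply; split=> /=; rewrite in_itv/=.
      by rewrite (quantile_ge0 u tf0 c0 m0) (quantile_le u tf0 c0 m0).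
    by rewrite (quantile_ge0 u tf0 cT mT) (quantile_le u tf0 cT mT).
  - by move=> A mA; exact: (uniform_prob_quantile tf0 c0 m0 mA).
  - by move=> A mA; exact: (uniform_prob_quantile tf0 cT mT mA).
have mN : measurable [set z : T | (z.2 : R) - z.1 < Delta].
  rewrite -[X in measurable X]setTI.
  apply: (@measurable_fun_ltr _ _ _ _
    (fun z : T => (z.2 : R) - z.1) (cst Delta)) => //.
  by apply: measurable_funB; [exact: measurable_snd|exact: measurable_fst].
exists [set z : T | (z.2 : R) - z.1 < Delta]; split => //.
  (* If [quantile muT u] is at least Delta, the maximum in [shift_dominated_quantile] is the
     difference and the travel time is long enough. Bad levels thus lie in the preimage of [0,
     Delta[, whose mass is that of [muT] there. *)
  rewrite /distribution /pushforward.
  apply: (@subset_measure0 _ _ _ (uniform_prob (@ltr01 R)) _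
    (quantile muT @^-1` `[0, Delta[)).
  - exact: (measurable_funPTI Z).
  - rewrite -[X in measurable X]setTI.
    exact: (mQT measurableT _ (measurable_itv _)).
  - move=> u /=; rewrite in_itv/= (quantile_ge0 u tf0 cT mT)/= => lt.
    move: (shift_dominated_quantile u tf0 D0 c0 cT m0 mT dom).
    apply: contraTT; rewrite -leNgt => DT.
    by rewrite max_l ?subr_ge0// -ltNge ltrBlDr -ltrBlDl.
  - rewrite -[RHS]muTD.
    exact: uniform_prob_quantile tf0 cT mT (measurable_itv _).
by move=> z /= /negP; rewrite -ltNge.
Qed.

(** * Domination tested on monotone functions *)

(** Puts the convention for t < Delta into the truncated form that also bounds the quantiles of
    [mu0]. *)
Lemma shift_funE (R : realType) (Delta : R) (phi : R -> R) (t : R) :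
  shift_fun Delta phi t = phi (Num.max (t - Delta) 0).
Proof.
rewrite /shift_fun; case: ltP => tD; first by rewrite max_r// subr_le0 ltW.
by rewrite max_l// subr_ge0.
Qed.

Lemma shift_fun_nondecreasing (R : realType) (Delta : R) (phi : R -> R) :
  {homo phi : x y / x <= y} -> {homo shift_fun Delta phi : x y / x <= y}.
Proof.
move=> hphi x y xy; rewrite !shift_funE; apply: hphi.
by rewrite ge_max !le_max lexx lerB// orbT.
Qed.

Lemma dominated_dominated_fun (R : realType) (tf Delta : R)
    (mu0 muT : {measure set (measurableTypeR R) -> \bar R}) :
  0 < tf -> 0 < Delta -> carried_by tf mu0 -> carried_by tf muT ->
  mu0 `[0, tf]%classic = 1%E -> muT `[0, tf]%classic = 1%E ->
  shift_dominated tf Delta mu0 muT -> shift_dominated_fun tf Delta mu0 muT.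
Proof.
move=> tf0 D0 c0 cT m0 mT dom phi bphi hphi.
have mphi : measurable_fun [set: R] phi by exact: nondecreasing_measurable.
have mS : measurable_fun [set: R] (shift_fun Delta phi).
  by apply: nondecreasing_measurable => //; exact: shift_fun_nondecreasing.
have bS : bounded_fun (shift_fun Delta phi).
  case: bphi => M [rM bM]; exists M; split=> // N MN t _ /=.
  by rewrite shift_funE; exact: bM.
rewrite (integral_quantile tf0 c0 m0 mphi bphi).
rewrite (integral_quantile tf0 cT mT mS bS).
apply: le_integral => //=.
- exact: (integrable_quantile tf0 c0 m0 mphi bphi).
- exact: (integrable_quantile tf0 cT mT mS bS).
move=> u _; rewrite lee_fin shift_funE; apply: hphi.
exact: shift_dominated_quantile tf0 D0 c0 cT m0 mT dom.
Qed.

Lemma dominated_fun_dominated (R : realType) (tf Delta : R)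
    (mu0 muT : {measure set (measurableTypeR R) -> \bar R}) :
  0 < Delta -> carried_by tf mu0 -> carried_by tf muT ->
  mu0 `[0, tf]%classic = 1%E -> muT `[0, tf]%classic = 1%E ->
  shift_dominated_fun tf Delta mu0 muT -> shift_dominated tf Delta mu0 muT.
Proof.
move=> D0 c0 cT m0 mT domf t /andP[t0 _].
pose phi : R -> R := \1_(`]t, +oo[%classic).
have tailE (mu : {measure set (measurableTypeR R) -> \bar R}) s :
    carried_by tf mu ->
    (\int[mu]_(x in `[0%R, tf]) (\1_(`]s, +oo[%classic) x)%:E =
     mu (`]s, +oo[%classic : set R))%E.
  move=> c; rewrite integral_indic//; [|exact: measurable_itv..].
  by apply: carried_setI => //; exact: measurable_itv.
have bphi : bounded_fun phi.
  exists 1; split=> // N N1 x _ /=; rewrite /phi indicE.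
  by case: (_ \in _); rewrite ?normr0 ?normr1 (le_trans _ (ltW N1)).
have hphi : {homo phi : x y / x <= y}.
  move=> x y xy; rewrite /phi !indicE !mem_setE !in_itv/= !andbT.
  by case: (ltP t x) => // tx; rewrite (lt_le_trans tx xy).
have := domf phi bphi hphi; rewrite tailE//.
rewrite (_ : (\int[muT]_(x in _) _)%E =
    muT (`]t + Delta, +oo[%classic : set R)); last first.
  rewrite -tailE//; apply: eq_integral => x _; congr EFin.
  rewrite shift_funE /phi !indicE !mem_setE !in_itv/= !andbT.
  (* Since t >= 0, the value 0 of the truncation never lies in ]t, +oo[. *)
  by rewrite lt_max [X in _ || X]ltNge t0 orbF ltrBrDr.
move=> le.
have tD0 : 0 <= t + Delta by rewrite addr_ge0// ltW.
have [f0 _] := cumul_fin t c0 m0; have [fT _] := cumul_fin (t + Delta) cT mT.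
have e0 := cumul_ltyE c0 m0 t0; have eT := cumul_ltyE cT mT tD0.
(* Complementation: once the finite tail of [muT] is added to both sides, the left one is 1, which
   is also the distribution function of [mu0] plus its smaller tail. *)
rewrite -(@leeD2rE _ (muT (`]t + Delta, +oo[%classic : set R))).
  by rewrite eT -e0 leeD2l.
by rewrite ge0_fin_numE// (@le_lt_trans _ _ 1%E) ?ltry// -eT leeDr.
Qed.

(** * From a feasible coupling to domination *)

Lemma le_measure_ae d (T : measurableType d) (R : realType)
    (mu : {measure set T -> \bar R}) (X Y : set T) :
  measurable X -> measurable Y -> {ae mu, forall z, X z -> Y z} ->
  (mu X <= mu Y)%E.
Proof.
move=> mX mY [N [mN N0 XYN]]; rewrite -[leRHS]adde0 -N0.
apply: le_trans (measureU2 _ mY mN); apply: le_measure; rewrite ?inE//.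
  exact: measurableU.
move=> z Xz; have [?|nYz] := pselect (Y z); first by left.
by right; apply: XYN => /(_ Xz).
Qed.

(** Under the coupling, arrival in [B] almost surely forces departure in [A]. General sets let one
    transfer principle serve both domination and the supports. *)
Lemma feasible_le (R : realType) (tf Delta : R)
    (mu0 muT : {measure set (measurableTypeR R) -> \bar R}) (A B : set R) :
  measurable A -> measurable B ->
  (forall s t, Delta <= t - s -> B t -> A s) ->
  feasible tf Delta mu0 muT -> (muT B <= mu0 A)%E.
Proof.
move=> mA mB BA [P [_ P0 PT] aeP]; rewrite -P0// -PT//.
apply: le_measure_ae; last first.
  by apply: negligibleS aeP => z nz Dz; apply: nz; exact: BA.
- rewrite -[X in measurable X]setTI.
  exact: (@measurable_fst _ _ (measurableTypeR R) (measurableTypeR R)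
    measurableT _ mA).
- rewrite -[X in measurable X]setTI.
  exact: (@measurable_snd _ _ (measurableTypeR R) (measurableTypeR R)
    measurableT _ mB).
Qed.

(** The same transfer in the direction of time, for the bound on suprema. *)
Lemma feasible_ge (R : realType) (tf Delta : R)
    (mu0 muT : {measure set (measurableTypeR R) -> \bar R}) (A B : set R) :
  measurable A -> measurable B ->
  (forall s t, Delta <= t - s -> A s -> B t) ->
  feasible tf Delta mu0 muT -> (mu0 A <= muT B)%E.
Proof.
move=> mA mB AB [P [_ P0 PT] aeP]; rewrite -P0// -PT//.
apply: le_measure_ae; last first.
  by apply: negligibleS aeP => z nz Dz; apply: nz; exact: AB.
- rewrite -[X in measurable X]setTI.
  exact: (@measurable_snd _ _ (measurableTypeR R) (measurableTypeR R)
    measurableT _ mB).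
- rewrite -[X in measurable X]setTI.
  exact: (@measurable_fst _ _ (measurableTypeR R) (measurableTypeR R)
    measurableT _ mA).
Qed.

Lemma feasible_dominated (R : realType) (tf Delta : R)
    (mu0 muT : {measure set (measurableTypeR R) -> \bar R}) :
  carried_by tf mu0 -> carried_by tf muT -> feasible tf Delta mu0 muT ->
  muT `[0, Delta[%classic = 0%E /\ shift_dominated tf Delta mu0 muT.
Proof.
move=> c0 cT fe.
have m0 (i : interval R) : measurable [set` i] by exact: measurable_itv.
have n0 : mu0 (`]-oo, 0[%classic : set R) = 0%E.
  rewrite -(carried_setI c0)// (_ : _ `&` _ = set0) ?measure0//.
  rewrite -subset0 => x /=; rewrite !in_itv/= => -[+ /andP[]].
  by rewrite ltNge => /negP.
split.
  (* An arrival before Delta would require a departure before 0, where [mu0] has no mass. *)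
  apply/eqP; rewrite -measure_le0 -n0; apply: feasible_le fe => //.
  move=> s t D /=; rewrite !in_itv/= => /andP[_ tD].
  by rewrite -(ltrD2l Delta) addr0 (le_lt_trans _ tD)// -lerBrDr.
move=> t _; rewrite /cumul -[leRHS](carried_setI c0)//.
(* The travel time bounds the departure only from above, so [0, t] is replaced by ]-oo, t], which
   has the same mass. *)
rewrite (_ : _ `&` _ = `]-oo, t] `&` `[0, tf]); last first.
  apply/predeqP => x /=; rewrite !in_itv/=.
  by split=> [[/andP[_ ->]]|[-> /andP[-> ->]]].
rewrite (carried_setI c0)//; apply: feasible_le fe => //.
move=> s x D /=; rewrite !in_itv/= => /andP[_ tD].
by rewrite -(lerD2r Delta) (le_trans _ tD)// addrC -lerBrDr.
Qed.

(** * Supports and their extreme points *)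

(** Compactness: otherwise the open null sets cover the segment, finitely many of them suffice, and
    the segment is null. *)
Lemma supp_meets_segment (R : realType)
    (mu : {measure set (measurableTypeR R) -> \bar R}) (a b : R) :
  (0 < mu (`[a, b]%classic : set R))%E -> exists2 x, supp mu x & a <= x <= b.
Proof.
move=> mu_gt0; apply: contrapT => nosupp.
pose D := [set U : set R | open U /\ mu U = 0%E].
have := @segment_compact R a b; rewrite compact_cover => /(_ (set R) D id).
case.
- by move=> U [].
- move=> x xab; have /existsNP[U] : ~ supp mu x.
    by move=> sx; apply: nosupp; exists x => //; move: xab; rewrite /= in_itv.
  move=> /not_implyP[oU] /not_implyP[Ux] /negP.
  by rewrite -leNgt measure_le0 => /eqP U0; exists U.
move=> E ED abE; suff : mu (`[a, b]%classic : set R) = 0%E.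
  by move=> e; rewrite e ltxx in mu_gt0.
have mE U : U \in E -> measurable U.
  by move=> /ED; rewrite inE => -[/open_measurable].
apply/negligibleP; first exact: measurable_itv.
apply: (@negligibleS _ (measurableTypeR R) R mu (\big[setU/set0]_(U <- E) U)).
  by move: abE; rewrite /cover bigcup_fset.
rewrite big_seq; elim/big_ind: _ => [||U UE].
- exact: negligible_set0.
- by move=> *; exact: negligibleU.
- apply/negligibleP; first exact: mE.
  by move: UE => /ED; rewrite inE => -[].
Qed.

Lemma supp_sub (R : realType) (tf : R)
    (mu : {measure set (measurableTypeR R) -> \bar R}) (x : R) :
  carried_by tf mu -> supp mu x -> 0 <= x <= tf.
Proof.
move=> c sx; apply: contrapT => nx.
have oC : open (~` `[0, tf]%classic : set R).
  by apply: closed_openC; exact: interval_closed.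
have : (0 < mu (~` `[0%R, tf]%classic))%E by apply: sx => //=; rewrite in_itv.
by rewrite c ltxx.
Qed.

(** A support point violating a bound leaves room for a midpoint y. The coupling carries the
    positive mass of a half-line cut at y over to the other measure, which then has a support point
    beyond its own infimum or supremum. *)
Lemma feasible_inf_sup (R : realType) (tf Delta : R)
    (mu0 muT : {measure set (measurableTypeR R) -> \bar R}) :
  carried_by tf mu0 -> carried_by tf muT ->
  mu0 `[0, tf]%classic = 1%E -> muT `[0, tf]%classic = 1%E ->
  feasible tf Delta mu0 muT ->
  inf (supp mu0) + Delta <= inf (supp muT) /\
  sup (supp mu0) + Delta <= sup (supp muT).
Proof.
move=> c0 cT m0 mT fe.
have mi (i : interval R) : measurable [set` i] by exact: measurable_itv.
have l0 : has_lbound (supp mu0) by exists 0 => x /(supp_sub c0)/andP[].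
have uT : has_ubound (supp muT) by exists tf => x /(supp_sub cT)/andP[].
(* Nonemptiness keeps [inf] and [sup] from taking their default value. *)
have ne (mu : {measure set (measurableTypeR R) -> \bar R}) :
    mu `[0, tf]%classic = 1%E -> supp mu !=set0.
  move=> m; have [|x sx _] := @supp_meets_segment R mu 0 tf; last by exists x.
  by rewrite m.
split.
  apply: lb_le_inf; first exact: ne.
  move=> x sx; rewrite leNgt; apply/negP => /midf_lt[].
  set y := _ / _ => xy yi.
  have : (0 < mu0 (`]-oo, (y - Delta)%R]%classic : set R))%E.
    have : (0 < muT (`]-oo, y[%classic : set R))%E.
      by apply: sx; [exact: interval_open|rewrite /= in_itv].
    move=> /lt_le_trans; apply; apply: feasible_le fe => //.
    move=> s t D /=; rewrite !in_itv/= => ty.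
    by rewrite lerBrDr (le_trans _ (ltW ty))// addrC -lerBrDr.
  (* Intersecting with the carrier makes the half-line a bounded segment, as compactness
     requires. *)
  rewrite -(carried_setI c0)// => pos.
  have [|z sz /andP[_ zy]] := @supp_meets_segment R mu0 0 (y - Delta).
    apply: (lt_le_trans pos); apply: le_measure; rewrite ?inE//.
      exact: measurableI.
    by move=> u /=; rewrite !in_itv/= => -[-> /andP[->]].
  have := ge_inf l0 sz; rewrite leNgt => /negP; apply.
  by rewrite (le_lt_trans zy)// ltrBlDr.
rewrite -lerBrDr; apply: ge_sup; first exact: ne.
move=> x sx; rewrite leNgt; apply/negP => /midf_lt[].
set y := _ / _ => yi xy.
have : (0 < muT (`[(y + Delta)%R, +oo[%classic : set R))%E.
  have : (0 < mu0 (`]y, +oo[%classic : set R))%E.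
    by apply: sx; [exact: interval_open|rewrite /= in_itv/= xy].
  move=> /lt_le_trans; apply; apply: feasible_ge fe => //.
  move=> s t D /=; rewrite !in_itv/= !andbT => ys.
  by rewrite (@le_trans _ _ (s + Delta)) ?lerD2r ?(ltW ys)// addrC -lerBrDr.
rewrite -(carried_setI cT)// => pos.
have [|z sz /andP[zy _]] := @supp_meets_segment R muT (y + Delta) tf.
  apply: (lt_le_trans pos); apply: le_measure; rewrite ?inE//.
    exact: measurableI.
  by move=> u /=; rewrite !in_itv/= andbT => -[-> /andP[_ ->]].
have := ub_le_sup uT sz; rewrite leNgt => /negP; apply.
by rewrite (lt_le_trans _ zy)// -ltrBlDr.
Qed.

Theorem lemma1 (R : realType) (tf Delta : R)
    (mu0 muT : {measure set (measurableTypeR R) -> \bar R})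
    (tf_gt0 : 0 < tf) (Delta_gt0 : 0 < Delta)
    (mu0_carried : carried_by tf mu0) (muT_carried : carried_by tf muT)
    (mu0_mass : mu0 `[0, tf]%classic = 1%E) (muT_mass : muT `[0, tf]%classic = 1%E) :
  [/\ feasible tf Delta mu0 muT <->
        muT `[0, Delta[%classic = 0%E /\ shift_dominated tf Delta mu0 muT,
      shift_dominated tf Delta mu0 muT <->
        shift_dominated_fun tf Delta mu0 muT
    & feasible tf Delta mu0 muT ->
        inf (supp mu0) + Delta <= inf (supp muT) /\
        sup (supp mu0) + Delta <= sup (supp muT)].
Proof.
split.
- split; first exact: feasible_dominated.
  by move=> [muT0 dom]; exact: dominated_feasible.
- split; first exact: dominated_dominated_fun.
  exact: dominated_fun_dominated.
- exact: feasible_inf_sup.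
Qed.
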